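(* There exist compact sets $X,Y\subset \mathbb{R}^3$ of positive Lebesgue measure such that $X$ and $Y$ cover each other, $\mu(X)=\mu(Y)$, and $X$ and $Y$ are not essentially equidecomposable.
   Context: $\mu$ denotes Lebesgue measure on $\mathbb{R}^3$ and $\operatorname{Iso}(\mathbb{R}^3)$ is the group of isometries of $\mathbb{R}^3$. Two sets $A,B\subset\mathbb{R}^3$ are equidecomposable if one can write $A=\bigsqcup_{i=1}^k A_i$ and $B=\bigsqcup_{i=1}^k B_i$ (finite disjoint unions of arbitrary, not necessarily measurable, sets) with $B_i=\gamma_i(A_i)$ for some $\gamma_i\in \operatorname{Iso}(\mathbb{R}^3)$. $A$ covers $B$ if $B\subset \bigcup_{i=1}^k\gamma_i(A)$ for some finitely many $\gamma_1,\ldots,\gamma_k\in \operatorname{Iso}(\mathbb{R}^3)$. $A$ and $B$ cover each other if $A$ covers $B$ and $B$ covers $A$. Measurable sets $A,B\subset\mathbb{R}^3$ are essentially equidecomposable if there exist measurable sets $A',B'\subset\mathbb{R}^3$ with $\mu(A\triangle A')=\mu(B\triangle B')=0$ such that $A'$ and $B'$ are equidecomposable. *)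

(* Defs.v *)
From HB Require Import structures.
From mathcomp Require Import all_boot all_order all_algebra.
From mathcomp Require Import all_classical all_reals all_analysis.
Set Implicit Arguments.
Unset Strict Implicit.
Unset Printing Implicit Defensive.
Import Order.TTheory GRing.Theory Num.Theory.
Import numFieldNormedType.Exports.
Local Open Scope classical_set_scope.
Local Open Scope ring_scope.

Notation R3 R := (R * R * R)%type.

(* The product topology on R3 is the Euclidean one, but the library norm on
   R3 is the sup norm, hence the explicit Euclidean distance. *)
Definition dist3 (R : realType) (x y : R3 R) : R :=
  Num.sqrt ((x.1.1 - y.1.1) ^+ 2 + (x.1.2 - y.1.2) ^+ 2 + (x.2 - y.2) ^+ 2).

Definition Iso (R : realType) : set (R3 R -> R3 R) :=
  [set g | bijective g /\ forall x y, dist3 (g x) (g y) = dist3 x y].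

Definition borel_mu (R : realType) :
    {measure set (R3 (measurableTypeR R)) -> \bar R} :=
  ((@lebesgue_measure R \x @lebesgue_measure R) \x @lebesgue_measure R)%E.

(* The product measure only makes sense on Borel sets; its outer-measure
   extension is complete, and its Caratheodory-measurable sets are exactly the
   Lebesgue-measurable ones. *)
Definition lebesgue_measurable (R : realType) : set (set (R3 R)) :=
  (borel_mu R)^*%mu.-cara.-measurable.

Definition mu (R : realType) : set (R3 R) -> \bar R :=
  @completed_measure_extension _ _ _ (borel_mu R).

(* The pieces are arbitrary sets, possibly nonmeasurable. *)
Definition equidecomposable (R : realType) (A B : set (R3 R)) : Prop :=
  exists (k : nat) (P Q : 'I_k -> set (R3 R)) (g : 'I_k -> R3 R -> R3 R),
    [/\ trivIset setT P /\ \bigcup_i P i = A,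
        trivIset setT Q /\ \bigcup_i Q i = B &
        forall i, Iso (g i) /\ Q i = g i @` P i].

Definition covers (R : realType) (A B : set (R3 R)) : Prop :=
  exists (k : nat) (g : 'I_k -> R3 R -> R3 R),
    (forall i, Iso (g i)) /\ B `<=` \bigcup_i (g i @` A).

Definition essentially_equidecomposable (R : realType) (A B : set (R3 R)) :
    Prop :=
  exists A' B' : set (R3 R),
    [/\ lebesgue_measurable A' /\ lebesgue_measurable B',
        mu (A `+` A') = 0%E, mu (B `+` B') = 0%E &
        equidecomposable A' B'].

(* Main.v *)
From HB Require Import structures.
Require Import Defs.
From mathcomp Require Import all_boot all_order all_algebra.
From mathcomp Require Import all_classical all_reals all_analysis.
From mathcomp Require Import measurable_realfun lra.
Import Order.TTheory GRing.Theory Num.Theory.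
Import numFieldNormedType.Exports.
Local Open Scope classical_set_scope.
Local Open Scope ring_scope.

(** The obstruction is a failure of Hall's condition on a set of positive
    measure: for every finite family of isometries, a non-null set of points
    [x] in [X] is such that [x] and its translate [x + v], also in [X], can only
    be sent to one and the same point of [Y], namely [x].

    Such an [X] is built around the arc [P] of the twisted cubic
    [t |-> (t, t^2, t^3)], [0 <= t <= 1].  This arc is rigid: an isometry that
    maps a subarc of [P] into [P] is the identity.  The arc is thickened to a
    compact set [K], the fringed cubic, such that
    - every neighbourhood of an interior point of [P] meets [K] in positive
      measure ([fringed_cubic_positive]), and
    - [K] contains no more isometric copies of subarcs of [P] than [P] does
      ([fringed_cubic_rigid]).
    Concretely [K] is the image under the shear
    [(x, y, z) |-> (x, y + x^2, z + x^3)] of the fringe [M], a fringed segment: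
    at height [y = a > 0] above its segment, [M] only has points whose first
    coordinate lies outside a neighbourhood of the rationals of total length at
    most [2 a].  An arc in [M] therefore lies either in the segment or in a
    plane [x = const] ([fringe_arc]), and an isometric copy of a subarc of [P]
    does neither.  The shear preserves volume, so [K] and [M] have the same
    measure.

    Take [X = K + (K + v) + M'] and [Y = K + M' + (M' + v)], disjoint unions in
    which [M'] is a translate of [M].  Both have measure [3 mu(M)], and they
    cover each other because [X] and [X + v] together contain [Y], and
    conversely.  For an isometry [g] other than the identity the parameters [t]
    with [g (P t)] in [Y] form a closed set with empty interior, so finitely
    many such isometries all move some point of [P], hence a whole
    neighbourhood [U] of it, out of [Y] ([rigid_neighborhood]).  Apply this to
    the isometries [g_i] of an equidecomposition and to the maps
    [x |-> g_i (x + v)]: for almost every [x] in [K] near that point, both [x]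
    and [x + v] are sent to [x], which is impossible.  The null sets by
    which the two sets may be altered cause no trouble, because isometries
    preserve null sets ([Iso_null]). *)

Set Implicit Arguments.
Unset Strict Implicit.

Local Notation borelR3 R := (R3 (measurableTypeR R)).

(** * Measure-preserving shears of the Euclidean space *)

Definition preserves {d} {T : measurableType d} {R : realType}
    (m : set T -> \bar R) (h : T -> T) : Prop :=
  measurable_fun setT h /\
  forall A, measurable A -> m (h @^-1` A) = m A.

Lemma preserves_translation (R : realType) (c : R) :
  preserves (@lebesgue_measure R) (fun x : measurableTypeR R => x + c).
Proof.
pose T := measurableTypeR R.
have mf : measurable_fun setT (fun x : T => (x + c : T)).
  by apply: measurable_funD => //; exact: measurable_cst.
split => // A mA; apply/esym.
apply: (@lebesgue_measure_unique R
  (pushforward (@lebesgue_measure R) (fun x : T => (x + c : T)))) => //.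
move=> _ [[a b] _ <-] /=; rewrite /pushforward /=.
have -> : (fun x : R => x + c) @^-1` `]a, b] = `]a - c, b - c]%classic.
  by apply/seteqP; split => x /=; rewrite !in_itv /= lerBrDr ltrBlDr.
rewrite !lebesgue_measure_itv /= !lte_fin ltrD2r.
by case: ifP => // _; rewrite -!EFinB; congr (_%:E); lra.
Qed.

(** By Tonelli: on the fibre above [x] the map is a translation followed by the
    passage to the fibre above [h x]. *)
Lemma preserves_skew d (T : measurableType d) (R : realType)
    (m : {measure set T -> \bar R}) (h : T -> T) (f : T -> measurableTypeR R) :
  preserves m h -> measurable_fun setT f ->
  preserves (m \x @lebesgue_measure R)%E
    (fun p : T * measurableTypeR R => (h p.1, p.2 + f p.1)).
Proof.
move=> [mh hm] mf.
have mk : measurable_fun setT (fun p : T * measurableTypeR R =>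
    (h p.1, p.2 + f p.1 : measurableTypeR R)).
  apply: measurable_fun_pair => /=.
    by apply: (measurableT_comp mh); exact: measurable_fst.
  apply: measurable_funD; first exact: measurable_snd.
  by apply: (measurableT_comp mf); exact: measurable_fst.
split=> // A mA.
rewrite /product_measure1.
transitivity (\int[m]_x ((@lebesgue_measure R) \o xsection A) (h x))%E.
  apply: eq_integral => x _ /=.
  rewrite -[RHS](preserves_translation (f x)).2; last first.
    exact: measurable_xsection.
  by congr (lebesgue_measure _); apply/seteqP; split => y /=;
    rewrite /xsection /= !inE.
have := @ge0_integral_pushforward _ _ _ _ _ h mh m setT _ measurableT
  (@measurable_fun_xsection _ _ _ _ _ (@lebesgue_measure R) A mA)
  (fun _ _ => measure_ge0 _ _).
rewrite preimage_setT => <-.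
by apply: (@eq_measure_integral _ _ _ _ m) => B mB _; exact: hm.
Qed.

Lemma preserves_skew3 (R : realType) (c : R) (f : R -> R) (h : R * R -> R) :
  measurable_fun setT f -> measurable_fun setT h ->
  preserves (borel_mu R)
    (fun x : borelR3 R => (x.1.1 + c, x.1.2 + f x.1.1, x.2 + h x.1)).
Proof.
move=> mf mh.
exact: (preserves_skew (preserves_skew (preserves_translation c) mf) mh).
Qed.

Lemma preserves_translation3 (R : realType) (a : R3 R) :
  preserves (borel_mu R) (fun x : borelR3 R => x + a).
Proof.
exact: (@preserves_skew3 R a.1.1 (cst a.1.2) (cst a.2)
  (measurable_cst _) (measurable_cst _)).
Qed.

Lemma borel_mu_box (R : realType) (A B C : set (measurableTypeR R)) :
  measurable A -> measurable B -> measurable C ->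
  borel_mu R (A `*` B `*` C) =
    (@lebesgue_measure R A * @lebesgue_measure R B * @lebesgue_measure R C)%E.
Proof.
move=> mA mB mC.
rewrite -(product_measure1E (@lebesgue_measure R) (@lebesgue_measure R) mA mB).
exact: (product_measure1E
  (@product_measure1 _ _ _ _ R (@lebesgue_measure R) (@lebesgue_measure R))
  (@lebesgue_measure R) (measurableX mA mB) mC).
Qed.

Lemma sigma_finite_prod d1 d2 (T1 : measurableType d1) (T2 : measurableType d2)
    (R : realType) (m1 : {sigma_finite_measure set T1 -> \bar R})
    (m2 : {sigma_finite_measure set T2 -> \bar R}) :
  sigma_finite setT (m1 \x m2)%E.
Proof.
have /sigma_finiteP[F [F_T F_nd F_fin]] := @sigma_finiteT _ _ _ m1.
have /sigma_finiteP[G [G_T G_nd G_fin]] := @sigma_finiteT _ _ _ m2.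
exists (fun n => F n `*` G n).
  apply/esym/seteqP; split => // -[x y] _.
  have [i _ Fx] : (\bigcup_n F n) x by rewrite -F_T.
  have [j _ Gy] : (\bigcup_n G n) y by rewrite -G_T.
  exists (maxn i j) => //; split => /=.
    exact: (subsetPset _ _ (F_nd _ _ (leq_maxl i j))).
  exact: (subsetPset _ _ (G_nd _ _ (leq_maxr i j))).
move=> n; have [mF Ffin] := F_fin n; have [mG Gfin] := G_fin n.
split; first exact: measurableX.
by rewrite product_measure1E // lte_mul_pinfty // ge0_fin_numE.
Qed.

(** The product measure packed with its sigma-finiteness, as Tonelli's theorem
    requires of its factors. *)
Definition prod_sigma_finite d1 d2 (T1 : measurableType d1)
    (T2 : measurableType d2) (R : realType)
    (m1 : {sigma_finite_measure set T1 -> \bar R})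
    (m2 : {sigma_finite_measure set T2 -> \bar R}) :
    {sigma_finite_measure set (T1 * T2)%type -> \bar R} :=
  HB.pack_for {sigma_finite_measure set (T1 * T2)%type -> \bar R} (m1 \x m2)%E
    (Measure_isSigmaFinite.Build _ _ _ (m1 \x m2)%E (sigma_finite_prod m1 m2)).

Definition sigma_finite_mu (R : realType) :
    {sigma_finite_measure set (borelR3 R) -> \bar R} :=
  prod_sigma_finite
    (prod_sigma_finite (@lebesgue_measure R) (@lebesgue_measure R))
    (@lebesgue_measure R).

Lemma sigma_finite_muE (R : realType) A : @sigma_finite_mu R A = borel_mu R A.
Proof. by []. Qed.

(** * Isometries are affine *)

Definition dot {R : realType} (x y : R3 R) : R :=
  x.1.1 * y.1.1 + x.1.2 * y.1.2 + x.2 * y.2.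

Definition affine_map {R : realType} (e u v w : R3 R) (x : R3 R) : R3 R :=
  (e.1.1 + x.1.1 * u.1.1 + x.1.2 * v.1.1 + x.2 * w.1.1,
   e.1.2 + x.1.1 * u.1.2 + x.1.2 * v.1.2 + x.2 * w.1.2,
   e.2 + x.1.1 * u.2 + x.1.2 * v.2 + x.2 * w.2).

Lemma dist3_inj (R : realType) (x y x' y' : R3 R) :
  dist3 x y = dist3 x' y' -> dot (x - y) (x - y) = dot (x' - y') (x' - y').
Proof.
have E (a b : R3 R) : dist3 a b ^+ 2 = dot (a - b) (a - b).
  rewrite /dist3 sqr_sqrtr ?addr_ge0 ?sqr_ge0 // /dot /=; lra.
by rewrite -!E => ->.
Qed.

Lemma dot_eq0 (R : realType) (x : R3 R) : dot x x = 0 -> x = 0.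
Proof.
move=> /eqP; rewrite /dot -!expr2 !paddr_eq0 ?addr_ge0 ?sqr_ge0 // !sqrf_eq0.
by case: x => [[a b] c] /= /andP[/andP[/eqP -> /eqP ->] /eqP ->].
Qed.

(** By polarization [x |-> g x - g 0] preserves the dot product, so the images
    [u], [v], [w] of the standard basis are orthonormal and the squared norm of
    [g x - g 0 - x1 u - x2 v - x3 w] expands to zero. *)
Lemma Iso_affine (R : realType) (g : R3 R -> R3 R) : Iso g ->
  exists e u v w : R3 R, [/\ g = affine_map e u v w,
    [/\ dot u u = 1, dot v v = 1 & dot w w = 1] &
    [/\ dot u v = 0, dot u w = 0 & dot v w = 0]].
Proof.
move=> [_ gd].
pose e := g 0; pose u := g (1, 0, 0) - e; pose v := g (0, 1, 0) - e.
pose w := g (0, 0, 1) - e.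
have D x y : dot (g x - g y) (g x - g y) = dot (x - y) (x - y).
  exact: dist3_inj.
have polar (x y : R3 R) : dot (g x - e) (g y - e) = dot x y.
  have := D x y; have := D x 0; have := D y 0; rewrite -/e /dot /=; lra.
exists e, u, v, w; split; last 2 first.
- by rewrite !polar /dot /=; split; lra.
- by rewrite !polar /dot /=; split; lra.
apply/funext => x; apply/subr0_eq/dot_eq0.
have uu : dot u u = 1 by rewrite polar /dot /=; lra.
have vv : dot v v = 1 by rewrite polar /dot /=; lra.
have ww : dot w w = 1 by rewrite polar /dot /=; lra.
have uv : dot u v = 0 by rewrite polar /dot /=; lra.
have uw : dot u w = 0 by rewrite polar /dot /=; lra.
have vw : dot v w = 0 by rewrite polar /dot /=; lra.
have xx := polar x x.
have xu : dot (g x - e) u = x.1.1 by rewrite polar /dot /=; lra.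
have xv : dot (g x - e) v = x.1.2 by rewrite polar /dot /=; lra.
have xw : dot (g x - e) w = x.2 by rewrite polar /dot /=; lra.
have -> : dot (g x - affine_map e u v w x) (g x - affine_map e u v w x) =
    dot (g x - e) (g x - e) - 2 * x.1.1 * dot (g x - e) u
    - 2 * x.1.2 * dot (g x - e) v - 2 * x.2 * dot (g x - e) w
    + x.1.1 ^+ 2 * dot u u + x.1.2 ^+ 2 * dot v v + x.2 ^+ 2 * dot w w
    + 2 * x.1.1 * x.1.2 * dot u v + 2 * x.1.1 * x.2 * dot u w
    + 2 * x.1.2 * x.2 * dot v w.
  move: (g x) => gx; rewrite /dot /affine_map /=; lra.
by rewrite uu vv ww uv uw vw xx xu xv xw /dot /=; lra.
Qed.

Lemma Iso_id (R : realType) : Iso (@id (R3 R)).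
Proof. by split => //; exists id. Qed.

Lemma Iso_comp (R : realType) (g h : R3 R -> R3 R) :
  Iso g -> Iso h -> Iso (g \o h).
Proof.
move=> [bg dg] [bh dh].
by split; [exact: bij_comp | move=> x y /=; rewrite dg dh].
Qed.

Lemma Iso_translation (R : realType) (v : R3 R) : Iso (fun x => x + v).
Proof.
split; first by exists (fun x => x - v) => x; rewrite ?addrK ?subrK.
move=> x y; rewrite /dist3 /=; congr (Num.sqrt (_ ^+ 2 + _ ^+ 2 + _ ^+ 2)); lra.
Qed.

Lemma Iso_add (R : realType) (g : R3 R -> R3 R) (x y : R3 R) : Iso g ->
  g (x + y) = g x + g y - g 0.
Proof.
move=> /Iso_affine[e [u [v [w [-> _ _]]]]]; rewrite /affine_map /=.
by congr (_, _, _) => /=; lra.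
Qed.

(** * Coordinates *)

Section coordinates.
Variable R : realType.

Lemma measurable_fst11 : measurable_fun setT (fun x : borelR3 R => x.1.1).
Proof. by apply: (measurableT_comp measurable_fst); exact: measurable_fst. Qed.

Lemma measurable_snd12 : measurable_fun setT (fun x : borelR3 R => x.1.2).
Proof. by apply: (measurableT_comp measurable_snd); exact: measurable_fst. Qed.

Lemma continuous_fst11 : continuous (fun x : R3 R => x.1.1).
Proof. by move=> x; apply: cvg_comp; [exact: cvg_fst | exact: cvg_fst]. Qed.

Lemma continuous_snd12 : continuous (fun x : R3 R => x.1.2).
Proof. by move=> x; apply: cvg_comp; [exact: cvg_fst | exact: cvg_snd]. Qed.

Lemma continuous_snd2 : continuous (fun x : R3 R => x.2).
Proof. by move=> x; exact: cvg_snd. Qed.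

Lemma continuous_shear (f h : R -> R) : continuous f -> continuous h ->
  continuous (fun x : R3 R => (x.1.1, x.1.2 + f x.1.1, x.2 + h x.1.1)).
Proof.
move=> cf ch x.
have c1 := @continuous_fst11 x; have c2 := @continuous_snd12 x.
have c3 := @continuous_snd2 x.
have c12 : (fun x : R3 R => x.1.2 + f x.1.1) @ x --> x.1.2 + f x.1.1.
  apply: cvgD; first exact: c2.
  by apply: (@cvg_comp _ _ _ (fun x : R3 R => x.1.1) f); [exact: c1 | exact: cf].
have c13 : (fun x : R3 R => x.2 + h x.1.1) @ x --> x.2 + h x.1.1.
  apply: cvgD; first exact: c3.
  by apply: (@cvg_comp _ _ _ (fun x : R3 R => x.1.1) h); [exact: c1 | exact: ch].
exact: (cvg_pair (cvg_pair c1 c12) c13).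
Qed.

Lemma Iso_continuous (g : R3 R -> R3 R) : Iso g -> continuous g.
Proof.
move=> /Iso_affine[e [u [v [w [-> _ _]]]]] x.
have c1 := @continuous_fst11 x; have c2 := @continuous_snd12 x.
have c3 := @continuous_snd2 x.
have L (p q r s : R) :
    (fun x : R3 R => p + x.1.1 * q + x.1.2 * r + x.2 * s) @ x
    --> p + x.1.1 * q + x.1.2 * r + x.2 * s.
  by repeat apply: cvgD; try exact: cvg_cst;
    apply: cvgM => //; exact: cvg_cst.
exact: (cvg_pair (cvg_pair (L _ _ _ _) (L _ _ _ _)) (L _ _ _ _)).
Qed.

Lemma Iso_measurable (g : R3 R -> R3 R) : Iso g ->
  measurable_fun setT (g : borelR3 R -> borelR3 R).
Proof.
move=> /Iso_affine[e [u [v [w [-> _ _]]]]].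
have mx1 := measurable_fst11; have mx2 := measurable_snd12.
have mx3 : measurable_fun setT (fun x : borelR3 R => x.2).
  exact: measurable_snd.
rewrite /affine_map; apply: measurable_fun_pair;
  first apply: measurable_fun_pair;
by do ?apply: measurable_funD; rewrite ?measurable_cst //;
  apply: measurable_funM => //; exact: measurable_cst.
Qed.

Lemma closed_le_fun (T : topologicalType) (f g : T -> R) :
  continuous f -> continuous g -> closed [set x | f x <= g x].
Proof.
move=> cf cg.
have -> : [set x | f x <= g x] = (g \- f) @^-1` [set y | 0 <= y].
  by apply/seteqP; split => x /=; rewrite subr_ge0.
apply: preimage_closed; last exact: closed_ge.
by move=> x _; apply: cvgB; [exact: cg | exact: cf].
Qed.

Lemma measurable_le_fun d (T : measurableType d) (f g : T -> R) :
  measurable_fun setT f -> measurable_fun setT g ->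
  measurable [set x | f x <= g x].
Proof.
move=> mf mg; rewrite -[X in measurable X]setTI.
have := measurable_fun_ler mf mg measurableT (I : measurable [set true]).
by congr (measurable _); apply/seteqP; split => x.
Qed.

Lemma compact_box (S : set (R3 R)) (a : R) : closed S ->
  (forall x, S x ->
    [/\ -a <= x.1.1 <= a, -a <= x.1.2 <= a & -a <= x.2 <= a]) ->
  compact S.
Proof.
move=> cS Sa.
apply: (subclosed_compact cS (B := `[-a, a] `*` `[-a, a] `*` `[-a, a])).
  by do 2?apply: compact_setX; exact: segment_compact.
by move=> x /Sa[? ? ?]; split; first split; rewrite /= in_itv.
Qed.

End coordinates.

(** * Isometries preserve null sets *)

Lemma null_borel_cover (R : realType) (N : set (R3 R)) : mu N = 0%E ->
  exists B : set (borelR3 R),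
    [/\ measurable B, N `<=` B & borel_mu R B = 0%E].
Proof.
move=> N0.
have cover n : exists C : set (borelR3 R),
    [/\ measurable C, N `<=` C & (borel_mu R C <= (n.+1%:R^-1)%:E)%E].
  have : (mu N < (n.+1%:R^-1)%:E)%E by rewrite N0 lte_fin invr_gt0 ltr0Sn.
  move=> /ereal_inf_lt[_ [F [mF NF] <-] Flt].
  exists (\bigcup_k F k); split => //; first exact: bigcupT_measurable.
  apply: le_trans (ltW Flt).
  by apply: measure_sigma_subadditive => //; exact: bigcupT_measurable.
pose C n := projT1 (cid (cover n)).
have mC n : measurable (C n) by rewrite /C; case: cid => ? [].
exists (\bigcap_n C n); split.
- exact: bigcapT_measurable.
- by move=> x Nx n _; rewrite /C; case: cid => ? [] /= _ + _; exact.
apply/eqP; rewrite eq_le measure_ge0 andbT; apply/lee_addgt0Pr => e e0.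
rewrite add0e.
near \oo => n.
apply: (@le_trans _ _ (borel_mu R (C n))).
  apply: le_measure; rewrite ?inE //; first exact: bigcapT_measurable.
  exact: bigcap_inf.
apply: (@le_trans _ _ (n.+1%:R^-1)%:E); first by rewrite /C; case: cid => ? [].
rewrite lee_fin ltW //.
near: n; exact: (near_infty_natSinv_lt (PosNum e0)).
Unshelve. all: by end_near.
Qed.

Lemma null_ysections d1 d2 (T1 : measurableType d1) (T2 : measurableType d2)
    (R : realType) (m1 : {sigma_finite_measure set T1 -> \bar R})
    (m2 : {sigma_finite_measure set T2 -> \bar R})
    (E : set (T1 * T2)) (c : \bar R) : measurable E ->
  (forall y, m1 (ysection E y) = 0%E) -> (forall x, m2 (xsection E x) = c) ->
  m1 setT = 0%E \/ c = 0%E.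
Proof.
move=> mE Ey Ex.
have := indic_fubini_tonelli m1 m2 mE.
rewrite indic_fubini_tonelli_FE // indic_fubini_tonelli_GE //.
rewrite [X in _ = X](_ : _ = 0%E); last first.
  by apply: integral0_eq => y _; exact: Ey.
rewrite (_ : m2 \o xsection E = cst c); last by apply/funext => x; exact: Ex.
by rewrite integral_cst // => /eqP; rewrite mule_eq0 => /orP[/eqP|/eqP];
  [right|left].
Qed.

(** Compute the measure of the set of pairs [(x, y)] with [x + g y] in [B] in
    two ways.  For fixed [y] the section is a translate of [B], hence null; for
    fixed [x] it is a translate of [g @^-1` B], because [g] is affine and onto.
    So [g @^-1` B] is null; this avoids the determinant of [g]. *)
Lemma Iso_null_preimage (R : realType) (g : R3 R -> R3 R)
    (B : set (borelR3 R)) :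
  Iso g -> measurable B -> borel_mu R B = 0%E -> borel_mu R (g @^-1` B) = 0%E.
Proof.
move=> Ig mB B0.
pose T := borelR3 R.
have mg := Iso_measurable Ig.
have mgB : measurable (g @^-1` B : set T).
  by rewrite -[X in measurable X]setTI; exact: mg.
pose E : set (T * T) := [set p | B (p.1 + g p.2)].
have mE : measurable E.
  have mf : measurable_fun setT (fun p : T * T => p.1 + g p.2 : T).
    have mfst : measurable_fun setT (fun p : T * T => p.1).
      exact: measurable_fst.
    have msnd : measurable_fun setT (fun p : T * T => g p.2).
      by apply: (measurableT_comp mg); exact: measurable_snd.
    apply: measurable_fun_pair; first apply: measurable_fun_pair.
    - apply: (@measurable_funD _ _ R _
        (fun p => p.1.1.1) (fun p => (g p.2).1.1)).
        by do 2 apply: (measurableT_comp measurable_fst).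
      by do 2 apply: (measurableT_comp measurable_fst).
    - apply: (@measurable_funD _ _ R _
        (fun p => p.1.1.2) (fun p => (g p.2).1.2)).
        by apply: (measurableT_comp measurable_snd);
          apply: (measurableT_comp measurable_fst).
      by apply: (measurableT_comp measurable_snd);
        apply: (measurableT_comp measurable_fst).
    - apply: (@measurable_funD _ _ R _ (fun p => p.1.2) (fun p => (g p.2).2)).
        exact: (measurableT_comp measurable_snd).
      exact: (measurableT_comp measurable_snd).
  by rewrite -[X in measurable X]setTI; exact: mf.
have [|x|muT0|//] := @null_ysections _ _ _ _ R
  (sigma_finite_mu R) (sigma_finite_mu R) E (borel_mu R (g @^-1` B)) mE.
- move=> y; rewrite sigma_finite_muE -B0.
  rewrite -((preserves_translation3 (g y)).2 B mB).
  by congr (borel_mu R _); apply/seteqP; split => x; rewrite /ysection /= inE.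
- have [h _ gK] : bijective g := Ig.1.
  rewrite sigma_finite_muE.
  rewrite -((preserves_translation3 (h (x + g 0))).2 _ mgB).
  have xE y : g (y + h (x + g 0)) = x + g y.
    by rewrite (Iso_add _ _ Ig) gK addrA addrK addrC.
  by congr (borel_mu R _); apply/seteqP; split => y;
    rewrite /xsection /= inE /E /= xE.
rewrite sigma_finite_muE in muT0.
apply/eqP; rewrite eq_le measure_ge0 andbT -muT0.
by apply: le_measure; rewrite ?inE.
Qed.

Lemma mu_borel (R : realType) (S : set (borelR3 R)) :
  measurable S -> mu S = borel_mu R S.
Proof. by move=> mS; exact: measurable_mu_extE. Qed.

Lemma mu_null_subset (R : realType) (A B : set (R3 R)) :
  A `<=` B -> mu B = 0%E -> mu A = 0%E.
Proof.
move=> AB B0; apply/eqP.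
by rewrite eq_le outer_measure_ge0 andbT -B0; exact: le_mu_ext.
Qed.

Lemma mu_nullU (R : realType) (A B : set (R3 R)) :
  mu A = 0%E -> mu B = 0%E -> mu (A `|` B) = 0%E.
Proof.
move=> A0 B0; apply/eqP; rewrite eq_le outer_measure_ge0 andbT.
have : (mu (A `|` B) <= mu A + mu B)%E.
  exact: (outer_measureU2 (borel_mu R)^*%mu A B).
by rewrite A0 B0 adde0.
Qed.

Lemma mu_null_bigcup (R : realType) (I : finType) (A : I -> set (R3 R)) :
  (forall i, mu (A i) = 0%E) -> mu (\bigcup_i A i) = 0%E.
Proof.
move=> A0.
have -> : \bigcup_i A i = \big[setU/set0]_(i <- enum I) A i.
  rewrite -bigcup_seq; apply/seteqP; split => x [i _ ?]; exists i => //=.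
  by rewrite mem_enum.
elim: (enum I) => [|i s IH]; first by rewrite big_nil; exact: outer_measure0.
by rewrite big_cons; exact: mu_nullU.
Qed.

Lemma Iso_null (R : realType) (g : R3 R -> R3 R) (N : set (R3 R)) :
  Iso g -> mu N = 0%E -> mu (g @^-1` N) = 0%E.
Proof.
move=> Ig /null_borel_cover[B [mB NB B0]].
have mgB : measurable (g @^-1` B : set (borelR3 R)).
  by rewrite -[X in measurable X]setTI; exact: (Iso_measurable Ig).
apply: (@mu_null_subset _ _ (g @^-1` B)); first by move=> x; exact: NB.
by rewrite mu_borel //; exact: Iso_null_preimage.
Qed.

(** * The fringe *)

(** In the slice at height [x.1.2 = a] the first coordinate avoids a
    neighbourhood of every rational, of size proportional to [a].  At [a = 0]
    nothing is removed and the slice is the segment on the first axis; as [a]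
    decreases to [0] the slices fill the interval up to a set of measure at
    most [2 a]. *)
Definition fringe (R : realType) : set (R3 R) :=
  [set x | [/\ 0 <= x.1.1 <= 1, 0 <= x.2 <= x.1.2, x.1.2 <= 1 &
    forall q : rat, x.1.2 / 2 ^+ (pickle q).+1 <= `|x.1.1 - ratr q| ]].

Definition gaps (R : realType) (e : R) : set R :=
  [set t | forall q : rat, e / 2 ^+ (pickle q).+1 <= `|t - ratr q| ].

Section fringe.
Variable R : realType.

Lemma fringe_box (x : R3 R) : fringe x ->
  [/\ 0 <= x.1.1 <= 1, 0 <= x.1.2 <= 1 & 0 <= x.2 <= 1].
Proof. by case=> ? /andP[? ?] ? _; split; lra. Qed.

Lemma fringe_inter : @fringe R =
  [set x | 0 <= x.1.1] `&` [set x | x.1.1 <= 1] `&` [set x | 0 <= x.2] `&`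
  [set x | x.2 <= x.1.2] `&` [set x | x.1.2 <= 1] `&`
  \bigcap_(q : rat)
    [set x | x.1.2 / 2 ^+ (pickle q).+1 <= `|x.1.1 - ratr q| ].
Proof.
apply/seteqP; split=> x.
  by case=> /andP[? ?] /andP[? ?] ? H;
    split; [split => //; split | move=> q _; exact: H].
by case=> -[[[[? ?] ?] ?] ?] H; split => //;
  [apply/andP | apply/andP | move=> q; exact: H].
Qed.

Lemma closed_fringe : closed (@fringe R).
Proof.
have c1 := @continuous_fst11 R; have c2 := @continuous_snd12 R.
have c3 := @continuous_snd2 R.
have cc (a : R) : continuous (fun _ : R3 R => a) by move=> x; exact: cvg_cst.
rewrite fringe_inter; repeat apply: closedI; try exact: closed_le_fun.
apply: closed_bigI => q _; apply: closed_le_fun.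
  by move=> x; apply: cvgM; [exact: c2 | exact: cvg_cst].
by move=> x; apply: cvg_norm; apply: cvgB; [exact: c1 | exact: cvg_cst].
Qed.

Lemma measurable_fringe : measurable (@fringe R : set (borelR3 R)).
Proof.
have c1 := @measurable_fst11 R; have c2 := @measurable_snd12 R.
have c3 : measurable_fun setT (fun x : borelR3 R => x.2) := measurable_snd.
have cc (a : R) : measurable_fun setT (fun _ : borelR3 R => a).
  exact: measurable_cst.
rewrite fringe_inter; repeat apply: measurableI;
  try exact: measurable_le_fun.
rewrite -[X in measurable X]setCK setC_bigcap; apply: measurableC.
apply: bigcupT_measurable_rat => q; apply: measurableC.
apply: measurable_le_fun.
  by apply: measurable_funM => //; exact: measurable_cst.
by apply: measurableT_comp => //; apply: measurable_funB.
Qed.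

Lemma measurable_gaps (e : R) : measurable (gaps e).
Proof.
have -> : gaps e = ~` \bigcup_(q : rat)
    ~` [set t | e / 2 ^+ (pickle q).+1 <= `|t - ratr q| ].
  rewrite -setC_bigcap setCK; apply/seteqP.
  by split => t H q; [move=> _|]; exact: H.
apply: measurableC.
apply: bigcupT_measurable_rat => q; apply: measurableC.
apply: measurable_le_fun => //.
by apply: measurableT_comp => //; apply: measurable_funB.
Qed.

(** The removed neighbourhoods of the rationals have lengths [e / 2^k], for
    distinct [k], so their total length is at most [2 e]. *)
Lemma gaps_positive (e a b : R) : 0 < e -> a + 2 * e < b ->
  (0 < @lebesgue_measure R (`]a, b[ `&` gaps e))%E.
Proof.
move=> e0 ab.
pose U k : set (measurableTypeR R) :=
  if unpickle k is Some q then ball (ratr q : R) (e / 2 ^+ k.+1) else set0.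
have mU k : measurable (U k).
  by rewrite /U; case: unpickle => // q; exact: measurable_ball.
have U_le k : (@lebesgue_measure R (U k) <= ((2 * e) / (2 ^ k.+1)%:R)%:E)%E.
  rewrite /U; case: unpickle => [q|].
    rewrite lebesgue_measure_ball; last by rewrite divr_ge0 ?ltW ?exprn_ge0.
    by rewrite lee_fin natrX -mulr_natr; lra.
  by rewrite measure0 lee_fin divr_ge0 //; lra.
have mG : measurable (`]a, b[ `&` gaps e : set (measurableTypeR R)).
  by apply: measurableI => //; exact: measurable_gaps.
have cover : `]a, b[ `<=` (`]a, b[ `&` gaps e) `|` \bigcup_k U k.
  move=> t abt; have [gt|/existsNP[q /negP]] := pselect (gaps e t).
    by left; exact: (conj abt gt).
  rewrite -ltNge => tq; right; exists (pickle q); first exact: I.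
  rewrite /U pickleK -ball_normE /ball_ /= distrC; exact: tq.
have : ((b - a)%:E <=
    @lebesgue_measure R (`]a, b[ `&` gaps e) + (2 * e)%:E)%E.
  have -> : (b - a)%:E = @lebesgue_measure R `]a, b[.
    rewrite lebesgue_measure_itv /= lte_fin (_ : a < b) ?EFinB //; lra.
  have mUU : measurable (\bigcup_k U k) by exact: bigcupT_measurable.
  apply: (@le_trans _ _ (@lebesgue_measure R
      ((`]a, b[ `&` gaps e) `|` \bigcup_k U k))).
    apply: le_measure; rewrite ?inE //; exact: measurableU.
  apply: (@le_trans _ _ (@lebesgue_measure R (`]a, b[ `&` gaps e) +
      @lebesgue_measure R (\bigcup_k U k)))%E.
    exact: measureU2.
  apply: leeD => //.
  apply: (@le_trans _ _ (\sum_(k <oo) @lebesgue_measure R (U k))%E).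
    exact: measure_sigma_subadditive.
  have e2 : 0 <= 2 * e by lra.
  apply: le_trans (epsilon_trick0 xpredT e2).
  by apply: lee_nneseries => [k|k] _; rewrite ?measure_ge0 ?U_le.
have := measure_ge0 (@lebesgue_measure R) (`]a, b[ `&` gaps e).
case: (lebesgue_measure _) => [r| |] //=.
by rewrite !lee_fin lte_fin; lra.
Qed.

(** The box [gaps e * ]e/2, e[ * ]0, e/2[] lies in the fringe: a point at height
    less than [e] has smaller neighbourhoods of the rationals to avoid than a
    point at height [e]. *)
Lemma fringe_positive (t r : R) : 0 < t < 1 -> 0 < r ->
  exists B : set (borelR3 R),
    [/\ measurable B, B `<=` @fringe R,
        (0 < borel_mu R B)%E &
        forall x, B x -> [/\ `|t - x.1.1| < r, `|x.1.2| < r & `|x.2| < r] ].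
Proof.
move=> t01 r0.
pose d := Num.min (Num.min t (1 - t)) r.
have d0 : 0 < d by rewrite !lt_min r0; lra.
have [d_t d_1t d_r] : [/\ d <= t, d <= 1 - t & d <= r].
  by rewrite !ge_min !lexx ?orbT; split.
(* the interval ]t - d, t + d[ has length 2 d, and 2 e must be less *)
pose e : R := d / 2.
pose B1 : set (measurableTypeR R) := `]t - d, t + d[ `&` gaps e.
pose B2 : set (measurableTypeR R) := `]e / 2, e[%classic.
pose B3 : set (measurableTypeR R) := `]0, e / 2[%classic.
have mB1 : measurable B1.
  by apply: measurableI => //; exact: measurable_gaps.
have mB2 : measurable B2 by exact: measurable_itv.
have mB3 : measurable B3 by exact: measurable_itv.
have mB12 : measurable (B1 `*` B2) by exact: measurableX.
exists (B1 `*` B2 `*` B3); split.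
- exact: measurableX.
- move=> [[x y] z] [[/= [+ gx] +] +].
  rewrite /B2 /B3 /= !in_itv /= => xI yI zI.
  have {}xI : t - d < x < t + d := xI; rewrite /e in yI zI.
  split => /=; [lra|lra|lra|move=> q].
  apply: le_trans (gx q).
  rewrite ler_pM2r ?invr_gt0 ?exprn_gt0 // /e; lra.
- rewrite borel_mu_box // !mule_gt0 //.
  + by apply: gaps_positive; rewrite /e; lra.
  + rewrite lebesgue_measure_itv /= lte_fin ifT -?EFinB ?lte_fin /e; lra.
  + rewrite lebesgue_measure_itv /= lte_fin ifT -?EFinB ?lte_fin /e; lra.
- move=> [[x y] z] [[/= [+ _] +] +].
  rewrite /B2 /B3 /= !in_itv /= /e => xI yI zI.
  by split; rewrite ltr_norml; lra.
Qed.

Lemma nbhs_subitv (a b t : R) (V : set R) : a < t < b -> nbhs t V ->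
  exists c d, [/\ a <= c, c < d, d <= b & forall s, c < s < d -> V s].
Proof.
move=> tab /nbhs_ballP[r /= r0 rV].
exists (Num.max a (t - r)), (Num.min b (t + r)); split.
- by rewrite le_max lexx.
- by rewrite gt_max !lt_min; lra.
- by rewrite ge_min lexx.
- move=> s; rewrite gt_max lt_min => /andP[/andP[? ?] /andP[? ?]].
  by apply: rV; rewrite -ball_normE /= ltr_norml; lra.
Qed.

Lemma continuous_irrational_constant (f : R -> R) (a b : R) :
  continuous f -> (forall t (q : rat), a < t < b -> f t <> ratr q) ->
  forall s t, a < s < b -> a < t < b -> f s = f t.
Proof.
move=> cf irr s t.
wlog st : s t / s <= t => [H|sab tab].
  by case: (leP s t) => [/H //|/ltW/H h ? ?]; rewrite h.
apply/eqP/negPn/negP => fst.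
have mM : Num.min (f s) (f t) < Num.max (f s) (f t).
  rewrite lt_max !gt_min.
  by move: fst; rewrite neq_lt => /orP[->|->]; rewrite ?orbT.
have [q] := rat_in_itvoo mM.
rewrite in_itv /= => /andP[/ltW q1 /ltW q2].
have [||z] := @IVT R f s t (ratr q) st.
- exact: continuous_subspaceT.
- by rewrite q1 q2.
rewrite in_itv /= => zst; apply: irr; lra.
Qed.

(** Where the height is positive, the first coordinate is irrational, hence
    constant by the intermediate value theorem. *)
Lemma fringe_arc (f : R -> R3 R) (a b : R) : continuous f -> a < b ->
  (forall t, a < t < b -> fringe (f t)) ->
  (forall t, a < t < b -> (f t).1.2 = 0 /\ (f t).2 = 0) \/
  exists c d k,
    [/\ a <= c, c < d, d <= b & forall t, c < t < d -> (f t).1.1 = k].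
Proof.
move=> cf ab fM.
have c1 : continuous (fun t => (f t).1.1).
  move=> t; apply: (@cvg_comp _ _ _ f (fun x : R3 R => x.1.1)).
    exact: cf.
  exact: continuous_fst11.
have c2 : continuous (fun t => (f t).1.2).
  move=> t; apply: (@cvg_comp _ _ _ f (fun x : R3 R => x.1.2)).
    exact: cf.
  exact: continuous_snd12.
have [[t0 [t0ab ft0]]|no] := pselect (exists t, a < t < b /\ 0 < (f t).1.2);
  [right|left].
  have : nbhs t0 [set t | 0 < (f t).1.2].
    exact: (cvgr_gt _ (c2 t0) _ ft0).
  move=> /(nbhs_subitv t0ab)[c [d [ac cd db H]]].
  exists c, d, (f ((c + d) / 2)).1.1; split => // t tcd.
  apply: (@continuous_irrational_constant (fun t => (f t).1.1) c d) => //;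
    last by lra.
  move=> s q scd fq; have [] := fM s _; first by lra.
  move=> _ _ _ /(_ q).
  rewrite fq subrr normr0 leNgt divr_gt0 ?exprn_gt0 //.
  exact: H.
move=> t tab; have [_ f0 _ _] := fM t tab.
have : ~ 0 < (f t).1.2 by move=> ft; apply: no; exists t.
by move=> /negP; rewrite -leNgt; lra.
Qed.

End fringe.

(** * The twisted cubic and its fringe *)

Definition cubic {R : realType} (t : R) : R3 R := (t, t ^+ 2, t ^+ 3).

Definition straighten {R : realType} (x : R3 R) : R3 R :=
  (x.1.1, x.1.2 - x.1.1 ^+ 2, x.2 - x.1.1 ^+ 3).

Definition bend {R : realType} (x : R3 R) : R3 R :=
  (x.1.1, x.1.2 + x.1.1 ^+ 2, x.2 + x.1.1 ^+ 3).

Definition fringed_cubic (R : realType) : set (R3 R) :=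
  straighten @^-1` @fringe R.

Section fringed_cubic.
Variable R : realType.

Lemma straightenK : cancel (@straighten R) bend.
Proof. by move=> [[x y] z]; rewrite /bend /= !subrK. Qed.

Lemma continuous_straighten : continuous (@straighten R).
Proof.
have cX n : continuous (fun t : R => - t ^+ n).
  by move=> t; apply: cvgN; exact: exprn_continuous.
exact: (continuous_shear (cX 2) (cX 3)).
Qed.

Lemma continuous_bend : continuous (@bend R).
Proof.
have cX n : continuous (fun t : R => t ^+ n) by exact: exprn_continuous.
exact: (continuous_shear (cX 2) (cX 3)).
Qed.

Lemma preserves_straighten : preserves (borel_mu R) (@straighten R).
Proof.
have [] := @preserves_skew3 R 0 (fun t => - t ^+ 2) (fun p => - p.1 ^+ 3).
- by apply: measurable_funN; exact: exprn_measurable.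
- apply: measurable_funN; apply: measurable_funX; exact: measurable_fst.
move=> mf pf.
have E : (fun x : R3 R => (x.1.1 + 0, x.1.2 + - x.1.1 ^+ 2,
    x.2 + - x.1.1 ^+ 3)) = @straighten R.
  by apply/funext => x; rewrite addr0.
by rewrite E in mf pf; split.
Qed.

Lemma fringed_cubic_box (x : R3 R) : fringed_cubic x ->
  [/\ 0 <= x.1.1 <= 1, 0 <= x.1.2 <= 2 & 0 <= x.2 <= 2].
Proof.
move=> /fringe_box[/= x1 x2 x3].
have /andP[? ?] : 0 <= x.1.1 ^+ 2 <= 1.
  by rewrite exprn_ge0 ?exprn_ile1; lra.
have /andP[? ?] : 0 <= x.1.1 ^+ 3 <= 1.
  by rewrite exprn_ge0 ?exprn_ile1; lra.
split; lra.
Qed.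

Lemma closed_fringed_cubic : closed (@fringed_cubic R).
Proof.
apply: preimage_closed; last exact: closed_fringe.
by move=> x _; exact: continuous_straighten.
Qed.

Lemma fringed_cubic_borel :
  measurable (@fringed_cubic R : set (borelR3 R)) /\
  borel_mu R (@fringed_cubic R) = borel_mu R (@fringe R).
Proof.
have [ms ps] := preserves_straighten; have mF := @measurable_fringe R.
split; last exact: ps.
by rewrite -[X in measurable X]setTI; exact: ms.
Qed.

Lemma fringed_cubic_positive (t : R) (U : set (R3 R)) : 0 < t < 1 ->
  nbhs (cubic t) U ->
  exists T : set (borelR3 R),
    [/\ measurable T, T `<=` @fringed_cubic R `&` U & (0 < borel_mu R T)%E].
Proof.
move=> t01 Ut.
have bt : bend (t, 0, 0) = cubic t by rewrite /bend /= !add0r.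
have : nbhs (t, 0, 0) (bend @^-1` U) by apply: continuous_bend; rewrite bt.
move=> /nbhs_ballP[r /= r0 rU].
have [B [mB BM B0 Br]] := fringe_positive t01 r0.
have [ms ps] := preserves_straighten.
exists (straighten @^-1` B); split.
- by rewrite -[X in measurable X]setTI; exact: ms.
- move=> x Bx; split; first exact: BM.
  rewrite -[x]straightenK; apply: rU.
  have [b1 b2 b3] := Br _ Bx.
  rewrite -normrN -sub0r in b2; rewrite -normrN -sub0r in b3.
  by split; [split|]; rewrite -ball_normE.
- by rewrite ps.
Qed.

Lemma continuous_comp_cubic (g : R3 R -> R3 R) : continuous g ->
  continuous (g \o cubic).
Proof.
move=> cg t; apply: (@cvg_comp _ _ _ cubic g); last exact: cg.
have cX n : (fun t : R => t ^+ n) @ t --> t ^+ n by exact: exprn_continuous.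
exact: (cvg_pair (cvg_pair (@cvg_id _ (nbhs t)) (cX 2)) (cX 3)).
Qed.

End fringed_cubic.

(** * Rigidity of arcs of the twisted cubic *)

Lemma poly_eq0_itv (R : realType) (s : seq R) (a b : R) : a < b ->
  (forall t, a < t < b -> horner_rec s t = 0) -> forall i, s`_i = 0.
Proof.
move=> ab H i.
rewrite -coef_Poly (_ : Poly s = 0) ?coef0 //.
apply/eqP/negPn/negP => s0.
pose r := [seq a + (b - a) / (k%:R + 2) | k <- iota 0 (size (Poly s))].
have := max_poly_roots s0 (_ : all (root (Poly s)) r) (_ : uniq r).
rewrite size_map size_iota ltnn => H'; suff : false by []; apply: H'.
  apply/allP => _ /mapP[k _ ->]; rewrite /root horner_Poly H //.
  have k0 : 0 <= k%:R :> R by rewrite ler0n.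
  have ? : 0 < (b - a) / (k%:R + 2) by rewrite divr_gt0; lra.
  have ? : (b - a) / (k%:R + 2) < b - a by rewrite ltr_pdivrMr; nra.
  by lra.
rewrite map_inj_uniq ?iota_uniq // => k l /addrI.
have ba : b - a != 0 by rewrite subr_eq0 gt_eqF.
by move=> /(mulfI ba) /invr_inj /addIr /eqP; rewrite eqr_nat => /eqP.
Qed.

Lemma cubic_poly_eq0 (R : realType) (c0 c1 c2 c3 a b : R) : a < b ->
  (forall t, a < t < b -> c0 + t * c1 + t ^+ 2 * c2 + t ^+ 3 * c3 = 0) ->
  [/\ c0 = 0, c1 = 0, c2 = 0 & c3 = 0].
Proof.
move=> ab H.
have K : forall i, [:: c0; c1; c2; c3]`_i = 0.
  by apply: (poly_eq0_itv ab) => t /H <- /=; lra.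
by split; [exact: (K 0) | exact: (K 1) | exact: (K 2) | exact: (K 3)].
Qed.

(** The cubic [t |-> dot n (g (cubic t))] being constant, [dot n] kills the
    linear part of [g], so [g] would map the space into a plane. *)
Lemma Iso_arc_not_planar (R : realType) (g : R3 R -> R3 R) (n : R3 R)
    (c a b : R) :
  Iso g -> a < b -> (forall t, a < t < b -> dot n (g (cubic t)) = c) -> n = 0.
Proof.
move=> Ig ab H; have [[h _ gK] _] := Ig.
have [e [u [v [w [gE _ _]]]]] := Iso_affine Ig.
have [E0 E1 E2 E3] :
    [/\ dot n e - c = 0, dot n u = 0, dot n v = 0 & dot n w = 0].
  apply: (cubic_poly_eq0 ab) => t /H.
  rewrite gE /dot /affine_map /cubic /=; lra.
have gn x : dot n (g x) = c.
  apply/subr0_eq.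
  have -> : dot n (g x) - c =
      (dot n e - c) + x.1.1 * dot n u + x.1.2 * dot n v + x.2 * dot n w.
    by rewrite gE /dot /affine_map /=; lra.
  by rewrite E0 E1 E2 E3 !mulr0 !addr0.
apply: dot_eq0.
have := gn (h (e + n)); rewrite gK.
have -> : dot n (e + n) = dot n e + dot n n by rewrite /dot /=; lra.
by lra.
Qed.

Lemma Iso_arc_coordinates (R : realType) (g : R3 R -> R3 R) (k a b : R) :
  Iso g -> a < b ->
  ~ (forall t, a < t < b -> (g (cubic t)).1.1 = k) /\
  ~ (forall t, a < t < b -> (g (cubic t)).1.2 = k).
Proof.
move=> Ig ab; split=> H.
  have n0 : (1, 0, 0) = 0 :> R3 R.
    apply: (Iso_arc_not_planar (c := k) Ig ab) => t /H <-.
    by rewrite /dot /=; lra.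
  by have := congr1 (fun x : R3 R => x.1.1) n0 => /= /eqP; rewrite oner_eq0.
have n0 : (0, 1, 0) = 0 :> R3 R.
  apply: (Iso_arc_not_planar (c := k) Ig ab) => t /H <-.
  by rewrite /dot /=; lra.
by have := congr1 (fun x : R3 R => x.1.2) n0 => /= /eqP; rewrite oner_eq0.
Qed.

(** Not lying in a plane, the arc [g (cubic t)] stays on the twisted cubic: its
    coordinates are polynomials [x], [y], [z] of degree at most 3 with
    [y = x^2] and [z = x^3].  Hence [x] has degree 1, orthonormality makes it
    [t] or [-t], and [-t] is excluded by [x >= 0]. *)
Lemma fringed_cubic_rigid (R : realType) (g : R3 R -> R3 R) (a b : R) :
  Iso g -> 0 <= a -> a < b ->
  (forall t, a < t < b -> fringed_cubic (g (cubic t))) -> g = id.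
Proof.
move=> Ig a0 ab gK.
have cf : continuous (fun t => straighten (g (cubic t))).
  move=> t; apply: (@cvg_comp _ _ _ (g \o cubic) straighten).
    by apply: continuous_comp_cubic; exact: Iso_continuous.
  exact: continuous_straighten.
have [f23|[c [d [k [ac cd db f1]]]]] := fringe_arc cf ab gK; last first.
  by case: ((Iso_arc_coordinates k Ig cd).1 f1).
have [e [u [v [w [gE [_ _ ww] [_ _ vw]]]]]] := Iso_affine Ig.
(* the coefficients of x^2 - y *)
pose s := [:: e.1.1 ^+ 2 - e.1.2; 2 * e.1.1 * u.1.1 - u.1.2;
  2 * e.1.1 * v.1.1 + u.1.1 ^+ 2 - v.1.2;
  2 * e.1.1 * w.1.1 + 2 * u.1.1 * v.1.1 - w.1.2;
  2 * u.1.1 * w.1.1 + v.1.1 ^+ 2; 2 * v.1.1 * w.1.1; w.1.1 ^+ 2].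
have s0 : forall i, s`_i = 0.
  apply: (poly_eq0_itv ab) => t /f23[+ _].
  by rewrite gE /affine_map /cubic /=; lra.
have /eqP := s0 6; rewrite /= sqrf_eq0 => /eqP w1.
have /= := s0 4; rewrite w1 mulr0 add0r => /eqP.
rewrite sqrf_eq0 => /eqP v1.
have /= e2 := s0 0; have /= u2 := s0 1; have /= v2 := s0 2.
have /= w2 := s0 3.
rewrite v1 w1 in v2 w2.
have [e3 u3 v3 w3] :
    [/\ e.2 - e.1.1 ^+ 3 = 0, u.2 - 3 * e.1.1 ^+ 2 * u.1.1 = 0,
        v.2 - 3 * e.1.1 * u.1.1 ^+ 2 = 0 & w.2 - u.1.1 ^+ 3 = 0].
  apply: (cubic_poly_eq0 ab) => t /f23[_ +].
  rewrite gE /affine_map /cubic /= v1 w1; lra.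
have {}w2 : w.1.2 = 0 by lra.
have {}v2 : v.1.2 = u.1.1 ^+ 2 by lra.
have {}w3 : w.2 = u.1.1 ^+ 3 by lra.
have {}v3 : v.2 = 3 * e.1.1 * u.1.1 ^+ 2 by lra.
have u11 : u.1.1 ^+ 2 = 1.
  apply/eqP; rewrite -(@pexpr_eq1 _ _ 3) ?sqr_ge0 //; apply/eqP.
  by rewrite -ww /dot w1 w2 w3; lra.
have e1 : e.1.1 = 0.
  move: vw; rewrite /dot v1 w1 w2 v3 w3.
  rewrite (_ : _ + _ =
    3 * e.1.1 * (u.1.1 ^+ 2) * (u.1.1 ^+ 2) * u.1.1); last by lra.
  rewrite u11 !mulr1 => /eqP; rewrite mulf_eq0 => /orP[/eqP|/eqP u0].
    by lra.
  by move: u11; rewrite u0; lra.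
have u1 : u.1.1 = 1.
  move/eqP: u11; rewrite sqrf_eq1 => /orP[/eqP //|/eqP u1].
  have [] := gK ((a + b) / 2) _; first by lra.
  by rewrite gE /straighten /affine_map /cubic /= e1 u1 v1 w1; lra.
rewrite e1 u1 in e2 e3 u2 u3 v2 v3 w3.
have {}e2 : e.1.2 = 0 by lra.
have {}e3 : e.2 = 0 by lra.
have {}u2 : u.1.2 = 0 by lra.
have {}u3 : u.2 = 0 by lra.
rewrite gE; apply/funext => -[[x y] z].
rewrite /affine_map /= e1 e2 e3 u1 u2 u3 v1 v2 v3 w1 w2 w3.
by congr (_, _, _); lra.
Qed.

(** * Translates along the first axis *)

Definition slide {R : realType} (c : R) (S : set (R3 R)) : set (R3 R) :=
  [set x | S (x - (c, 0, 0))].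

Definition in_slab (R : realType) (c : R) (A : set (R3 R)) : Prop :=
  forall x, A x -> c <= x.1.1 <= c + 1.

Section slide.
Variable R : realType.

Lemma slide0 (S : set (R3 R)) : slide 0 S = S.
Proof.
by apply/seteqP; split => x; rewrite /slide /= (_ : (0, 0, 0) = 0) // subr0.
Qed.

Lemma closed_slide (c : R) (S : set (R3 R)) : closed S -> closed (slide c S).
Proof.
move=> cS; apply: preimage_closed cS => x _.
by apply: cvgB; [exact: cvg_id | exact: cvg_cst].
Qed.

Lemma compact_slide (c : R) (S : set (R3 R)) : 0 <= c <= 6 -> closed S ->
  (forall x, S x -> [/\ 0 <= x.1.1 <= 1, 0 <= x.1.2 <= 2 & 0 <= x.2 <= 2]) ->
  compact (slide c S).
Proof.
move=> c06 cS Sb; apply: (@compact_box R _ 9); first exact: closed_slide.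
by move=> x /Sb /= [? ? ?]; split; lra.
Qed.

Lemma slide_borel (c : R) (S : set (borelR3 R)) :
  measurable S -> measurable (slide c S : set (borelR3 R)) /\
  borel_mu R (slide c S) = borel_mu R S.
Proof.
move=> mS; have [mt pt] := preserves_translation3 (- (c, 0, 0) : R3 R).
split; last exact: pt.
by rewrite -[X in measurable X]setTI; exact: mt.
Qed.

Lemma in_slab_slide (c : R) (A : set (R3 R)) :
  in_slab 0 A -> in_slab c (slide c A).
Proof. by move=> A0 x /A0 /=; lra. Qed.

Lemma in_slab_fringe : in_slab 0 (@fringe R).
Proof. by move=> x /fringe_box[]; lra. Qed.

Lemma in_slab_fringed_cubic : in_slab 0 (@fringed_cubic R).
Proof. by move=> x /fringed_cubic_box[]; lra. Qed.

Lemma slab_disjoint (c d : R) (A B : set (R3 R)) :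
  in_slab c A -> in_slab d B -> (c + 1 < d) || (d + 1 < c) ->
  A `&` B `<=` set0.
Proof. by move=> cA dB cd x [/cA ? /dB ?]; exfalso; case/orP: cd; lra. Qed.

Lemma covers_slide (c : R) (A B : set (R3 R)) :
  B `<=` A `|` slide c A -> covers A B.
Proof.
move=> BA.
exists 2, (fun i : 'I_2 => if i == ord0 then id else fun x => x + (c, 0, 0)).
split.
  by move=> i; case: ifP => _; [exact: Iso_id | exact: Iso_translation].
move=> x /BA[Ax|Ax]; first by exists ord0 => //; exists x.
by exists ord_max => //; exists (x - (c, 0, 0)); rewrite //= subrK.
Qed.

Lemma compact_fringed_cubic c :
  0 <= c <= 6 -> compact (slide c (@fringed_cubic R)).
Proof.
move=> c6; apply: compact_slide c6 (@closed_fringed_cubic R) _.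
exact: fringed_cubic_box.
Qed.

Lemma compact_fringe c : 0 <= c <= 6 -> compact (slide c (@fringe R)).
Proof.
move=> c6; apply: compact_slide c6 (@closed_fringe R) _ => x.
by move=> /fringe_box[? ? ?]; split; lra.
Qed.

(** An isometric copy of a subarc lies neither on the segment of the fringe nor
    in a plane [x = const]. *)
Lemma fringe_no_arc (g : R3 R -> R3 R) (c a b : R) :
  Iso g -> a < b ->
  ~ (forall t, a < t < b -> slide c (@fringe R) (g (cubic t))).
Proof.
move=> Ig ab gM.
have cf : continuous (fun t => g (cubic t) - (c, 0, 0)).
  move=> t; apply: cvgB; last exact: cvg_cst.
  by apply: continuous_comp_cubic; exact: Iso_continuous.
have [f23|[c' [d [k [_ cd _ f1]]]]] := fringe_arc cf ab gM.
  case: (Iso_arc_coordinates 0 Ig ab).2 => t.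
  by move=> /f23[/= + _]; rewrite subr0.
case: (Iso_arc_coordinates (k + c) Ig cd).1 => t.
by move=> /f1 /= <-; rewrite subrK.
Qed.

End slide.

(** * The two compact sets *)

Definition doubled_cubic (R : realType) : set (R3 R) :=
  @fringed_cubic R `|` slide 4 (@fringed_cubic R) `|` slide 2 (@fringe R).

Definition doubled_fringe (R : realType) : set (R3 R) :=
  @fringed_cubic R `|` slide 2 (@fringe R) `|` slide 6 (@fringe R).

Section two_sets.
Variable R : realType.

Lemma compact_doubled_cubic : compact (@doubled_cubic R).
Proof.
rewrite /doubled_cubic -{1}[@fringed_cubic R]slide0.
by do 2?apply: compactU;
  [apply: compact_fringed_cubic..|apply: compact_fringe]; lra.
Qed.

Lemma compact_doubled_fringe : compact (@doubled_fringe R).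
Proof.
rewrite /doubled_fringe -{1}[@fringed_cubic R]slide0.
by do 2?apply: compactU;
  [apply: compact_fringed_cubic|apply: compact_fringe..]; lra.
Qed.

Lemma closed_doubled_fringe : closed (@doubled_fringe R).
Proof.
by do 2?apply: closedU; [exact: closed_fringed_cubic | apply: closed_slide..];
  exact: closed_fringe.
Qed.

Lemma mu_U3 (A B C : set (borelR3 R)) (m : \bar R) :
  measurable A /\ borel_mu R A = m -> measurable B /\ borel_mu R B = m ->
  measurable C /\ borel_mu R C = m ->
  [/\ A `&` B `<=` set0, A `&` C `<=` set0 & B `&` C `<=` set0] ->
  mu (A `|` B `|` C) = (m + m + m)%E.
Proof.
move=> [mA Am] [mB Bm] [mC Cm] [AB AC BC].
have mAB : measurable (A `|` B) by exact: measurableU.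
rewrite mu_borel; last exact: measurableU.
have -> : borel_mu R (A `|` B `|` C) =
    (borel_mu R (A `|` B) + borel_mu R C)%E.
  apply: measureU => //; rewrite -subset0 => x [[Ax|Bx] Cx].
    exact: (AC x).
  exact: (BC x).
rewrite Cm; congr (_ + _)%E.
have -> : borel_mu R (A `|` B) = (borel_mu R A + borel_mu R B)%E.
  by apply: measureU => //; rewrite -subset0.
by rewrite Am Bm.
Qed.

Lemma mu_doubled_eq : mu (@doubled_cubic R) = mu (@doubled_fringe R).
Proof.
have FC := @fringed_cubic_borel R; have mF := @measurable_fringe R.
have F c := @slide_borel R c _ mF.
have C4 := @slide_borel R 4 _ FC.1; rewrite FC.2 in C4.
have sC := @in_slab_fringed_cubic R.
have sC4 := in_slab_slide (c := 4) sC.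
have sF c := in_slab_slide (c := c) (@in_slab_fringe R).
rewrite /doubled_cubic /doubled_fringe (mu_U3 FC C4 (F 2)); last first.
  split; [apply: slab_disjoint sC sC4 _ | apply: slab_disjoint sC (sF 2) _
         | apply: slab_disjoint sC4 (sF 2) _]; clear; apply/orP; lra.
rewrite (mu_U3 FC (F 2) (F 6)) //.
split; [apply: slab_disjoint sC (sF 2) _ | apply: slab_disjoint sC (sF 6) _
       | apply: slab_disjoint (sF 2) (sF 6) _]; clear; apply/orP; lra.
Qed.

Lemma arc_leaves_closed (f : R -> R3 R) (S : set (R3 R)) (a b : R) :
  continuous f -> closed S -> ~ (forall t, a < t < b -> S (f t)) ->
  exists c d, [/\ a <= c, c < d, d <= b & forall t, c < t < d -> ~ S (f t)].
Proof.
move=> cf cS /existsNP[t /not_implyP[tab nSt]].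
apply: (nbhs_subitv tab).
apply: (cf t (~` S)); apply: open_nbhs_nbhs; split => //.
exact: closed_openC.
Qed.

(** The interval is shrunk three times, to leave one closed piece after the
    other: the first by rigidity of the arc, the two fringes because they
    contain no copy of it. *)
Lemma arc_leaves_doubled_fringe (g : R3 R -> R3 R) (a b : R) :
  Iso g -> g <> id -> 0 <= a -> a < b ->
  exists c d, [/\ a <= c, c < d, d <= b &
    forall t, c < t < d -> ~ doubled_fringe (g (cubic t))].
Proof.
move=> Ig gid a0 ab.
have cg := continuous_comp_cubic (Iso_continuous Ig).
have cF c := closed_slide (c := c) (@closed_fringe R).
have [c1 [d1 [ac1 cd1 db1 H1]]] :=
  arc_leaves_closed cg (@closed_fringed_cubic R)
    (fun H => gid (fringed_cubic_rigid Ig a0 ab H)).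
have [c2 [d2 [cc2 cd2 dd2 H2]]] :=
  arc_leaves_closed cg (cF 2) (fringe_no_arc Ig cd1).
have [c3 [d3 [cc3 cd3 dd3 H3]]] :=
  arc_leaves_closed cg (cF 6) (fringe_no_arc Ig cd2).
exists c3, d3; split; [lra|lra|lra|].
move=> t tcd [[|]|]; [apply: H1 | apply: H2 | apply: H3]; lra.
Qed.

Lemma common_leaving_arc (I : eqType) (h : I -> R3 R -> R3 R) (s : seq I) :
  (forall i, Iso (h i)) ->
  exists c d, [/\ 0 <= c, c < d, d <= 1 &
    forall t i, c < t < d -> i \in s ->
      doubled_fringe (h i (cubic t)) -> h i = id].
Proof.
move=> Ih; elim: s => [|i s [c [d [c0 cd d1 H]]]].
  by exists 0, 1; split => //; exact: ltr01.
have [hi|hi] := pselect (h i = id).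
  exists c, d; split => // t j tcd.
  by rewrite inE => /orP[/eqP -> //|]; exact: H.
have [c' [d' [cc' cd' dd' H']]] := arc_leaves_doubled_fringe (Ih i) hi c0 cd.
exists c', d'; split; [lra|lra|lra|].
move=> t j tcd; rewrite inE => /orP[/eqP ->|js] Y.
  by have := H' t tcd Y.
by apply: (H t j) => //; lra.
Qed.

Lemma rigid_neighborhood (I : finType) (h : I -> R3 R -> R3 R) :
  (forall i, Iso (h i)) ->
  exists2 t, 0 < t < 1 &
    \forall x \near cubic t, forall i, doubled_fringe (h i x) -> h i = id.
Proof.
move=> Ih; have [c [d [c0 cd d1 H]]] := common_leaving_arc (enum I) Ih.
exists ((c + d) / 2); first by lra.
suff near_i i : nbhs (cubic ((c + d) / 2))
    [set x | doubled_fringe (h i x) -> h i = id].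
  exact: (filter_forall _ near_i).
have [hi|hi] := pselect (h i = id).
  by apply: filterS filterT => x _ _.
have nY : ~ doubled_fringe (h i (cubic ((c + d) / 2))).
  by move=> /(H _ i) hid; apply/hi/hid; [lra | rewrite mem_enum].
have : nbhs (cubic ((c + d) / 2)) (h i @^-1` (~` @doubled_fringe R)).
  apply: (Iso_continuous (Ih i)); apply: open_nbhs_nbhs; split => //.
  by apply: closed_openC; exact: closed_doubled_fringe.
by apply: filterS => x nYx /nYx.
Qed.

(** Both [x] and [x + v] can only be sent to [x], for all [x] outside a null set
    in a set of positive measure. *)
Lemma doubled_not_essentially_equidecomposable :
  ~ essentially_equidecomposable (@doubled_cubic R) (@doubled_fringe R).
Proof.
move=> [A [B [_ AX BY [k [P [Q [g [[tP PA] [tQ QB] gPQ]]]]]]]].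
(* the vector that carries the first copy of the fringed cubic to the second *)
pose v : R3 R := (4, 0, 0).
pose h (j : 'I_k * bool) : R3 R -> R3 R :=
  if j.2 then g j.1 \o (fun x => x + v) else g j.1.
have Ih j : Iso (h j).
  rewrite /h; case: ifP => _; last by have [] := gPQ j.1.
  by apply: Iso_comp (Iso_translation _); have [] := gPQ j.1.
have [t t01 near_t] := rigid_neighborhood Ih.
have [T [mT TK T0]] := fringed_cubic_positive t01 near_t.
pose NA := @doubled_cubic R `+` A; pose NB := @doubled_fringe R `+` B.
pose bad := NA `|` (fun x => x + v) @^-1` NA `|` \bigcup_j (h j @^-1` NB).
have bad0 : mu bad = 0%E.
  apply: mu_nullU.
    by apply: mu_nullU => //; apply: Iso_null => //; exact: Iso_translation.
  by apply: mu_null_bigcup => j; exact: Iso_null.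
suff Tbad : T `<=` bad.
  by move: T0; rewrite -mu_borel // (mu_null_subset Tbad bad0) ltxx.
move=> x Tx; apply: contrapT => nbad.
have [Kx rigid] := TK x Tx.
have Ax : A x.
  apply: contrapT => nA; apply: nbad; left; left; left; split => //.
  by left; left.
have Axv : A (x + v).
  apply: contrapT => nA; apply: nbad; left; right; left; split => //.
  by left; right; rewrite /slide /= addrK.
have fixed j : B (h j x) -> h j = id.
  move=> Bx; apply: rigid; apply: contrapT => nY.
  by apply: nbad; right; exists j => //; right.
have [i _ Pi] : (\bigcup_i P i) x by rewrite PA.
have [j _ Pj] : (\bigcup_i P i) (x + v) by rewrite PA.
have Qi : Q i (g i x) by rewrite (gPQ i).2; exists x.
have Qj : Q j (g j (x + v)) by rewrite (gPQ j).2; exists (x + v).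
have gi : g i = id by apply: (fixed (i, false)); rewrite -QB; exists i.
have gj : g j \o (fun x => x + v) = id.
  by apply: (fixed (j, true)); rewrite -QB; exists j.
have gjx : g j (x + v) = x by exact: (congr1 (fun f => f x) gj).
rewrite gi /= in Qi; rewrite gjx in Qj.
have ij : i = j by apply: tQ => //; exists x.
rewrite -ij gi in gjx.
have /(congr1 (fun x : R3 R => x.1.1)) /= : x + v = x := gjx.
lra.
Qed.

Lemma mu_doubled_cubic_gt0 : (0 < mu (@doubled_cubic R))%E.
Proof.
have half : 0 < (2^-1 : R) < 1 by lra.
have [T [mT TK T0]] := fringed_cubic_positive half filterT.
rewrite lt0e outer_measure_ge0 andbT; apply/eqP => X0.
have TX : T `<=` @doubled_cubic R by move=> x /TK[Kx _]; left; left.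
by move: T0; rewrite -mu_borel // (mu_null_subset TX X0) ltxx.
Qed.

End two_sets.

Unset Implicit Arguments.

Theorem theorem1p4 (R : realType) :
  exists X Y : set (R * R * R),
    [/\ compact X /\ compact Y,
        (0 < mu X)%E /\ (0 < mu Y)%E,
        covers X Y /\ covers Y X,
        mu X = mu Y &
        ~ essentially_equidecomposable X Y].
Proof.
exists (@doubled_cubic R), (@doubled_fringe R); split.
- by split; [exact: compact_doubled_cubic | exact: compact_doubled_fringe].
- by rewrite -mu_doubled_eq; split; exact: mu_doubled_cubic_gt0.
- split; apply: (@covers_slide R 4).
  + move=> x [[Kx|Mx]|Mx];
      [by left; left; left | by left; right | right; right].
    move: Mx; rewrite /slide /= -addrA; congr (fringe (x + _)).
    by congr (_, _, _) => /=; lra.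
  + by move=> x [[Kx|Kx]|Mx];
      [left; left; left | right; left; left | left; left; right].
- exact: mu_doubled_eq.
- exact: doubled_not_essentially_equidecomposable.
Qed.
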